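(* Let $X$ be a real Banach space, let $S\subset X$ be a closed set and let $\bar{x}$ be a point of the boundary $\mathrm{bdry}\,S$ of $S$ (so $\bar{x}\in S$). Suppose that $S$ is epi-Lipschitzian at $\bar{x}$. Then $S$ is strictly Hadamard differentiable at $\bar{x}$ if and only if the Clarke tangent cone $T(S,\bar{x})$ contains a closed hyperplane.
   Context: $B(x,r)$ denotes the ball of centre $x$ and radius $r$. Hyperplane: a closed hyperplane of $X$ is a closed linear subspace of codimension $1$. Clarke tangent cone: for $A\subset X$ and $a\in A$, $T(A,a)$ is the set of all $v\in X$ such that for every sequence $(x_n)$ in $A$ converging to $a$ and every sequence $(t_n)$ of positive reals converging to $0$ there is a sequence $(v_n)$ in $X$ converging to $v$ with $x_n+t_nv_n\in A$ for all sufficiently large $n$. Epi-Lipschitzian: $S$ is epi-Lipschitzian at $\bar{x}\in S$ if there exist $\bar{v}\in X\setminus\{0\}$ and $\gamma>0$ such that $S\cap B(\bar{x},\gamma)+tB(\bar{v},\gamma)\subset S$ for all $t\in\,]0,\gamma[$. Local representation: if the closed set $S$ is epi-Lipschitzian at $\bar{x}\in\mathrm{bdry}\,S$, there exist $\bar{v}\in X\setminus\{0\}$, a closed hyperplane $E$ with $X=E\oplus\mathbb{R}\bar{v}$, a neighbourhood $\Omega$ of $\bar{x}$ and a function $f:E\to\mathbb{R}$ that is locally Lipschitzian near $\pi_E(\bar{x})$ such that $\Omega\cap S=\Omega\cap\{u+r\bar{v}: u\in E,\ r\in\mathbb{R},\ f(u)\le r\}$, where $\pi_E$ is the projection onto $E$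 along $\mathbb{R}\bar{v}$. Such an $f$ is called a local representation of $S$ near $\bar{x}$. Strict Hadamard differentiability of a mapping: a mapping $g:X\to Y$ between normed spaces is strictly Hadamard differentiable at $\bar{x}$ if there is a continuous linear map $Dg(\bar{x}):X\to Y$ such that, for every $h\in X$, $\frac{g(x+tu)-g(x)}{t}\to Dg(\bar{x})(h)$ as $t\to0^+$, $x\to\bar{x}$, $u\to h$. Strict Hadamard differentiability of a set: fix any local representation $f$ of $S$ near $\bar{x}$, that is, fix $\bar{v}\in X\setminus\{0\}$, a closed hyperplane $E$ with $X=E\oplus\mathbb{R}\bar{v}$, a neighbourhood $\Omega$ of $\bar{x}$ and a function $f:E\to\mathbb{R}$ locally Lipschitzian near $\pi_E(\bar{x})$ such that $\Omega\cap S=\Omega\cap\{u+r\bar{v}: u\in E,\ r\in\mathbb{R},\ f(u)\le r\}$, where $\pi_E$ is the projection onto $E$ along $\mathbb{R}\bar{v}$; $S$ (epi-Lipschitzian at $\bar{x}$) is called strictly Hadamard differentiable at $\bar{x}$ if $f$ is strictly Hadamard differentiable at $\pi_E(\bar{x})$. *)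

(* Defs.v *)
From HB Require Import structures.
From mathcomp Require Import all_boot all_order all_algebra.
From mathcomp Require Import all_classical all_reals all_analysis.

Set Implicit Arguments.
Unset Strict Implicit.
Unset Printing Implicit Defensive.
Import Order.TTheory GRing.Theory Num.Theory.
Import numFieldNormedType.Exports.
Local Open Scope classical_set_scope.
Local Open Scope ring_scope.

(* A linear subspace is a [submodClosed X], i.e. a (boolean, hence classically
   arbitrary) predicate on [X] closed under 0, addition and scaling.
   [subspace_of E] is [E] as a type, normed by the restriction of the norm
   of [X]. *)
Section SubspaceOf.
Context {R : realType} {X : normedModType R}.

Definition subspace_of (E : submodClosed X) : Type := {x : X | x \in E}.

Variable E : submodClosed X.

HB.instance Definition _ := SubChoice.on (subspace_of E).
HB.instance Definition _ :=
  [SubChoice_isSubLmodule of subspace_of E by <:].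

Let norm_of (u : subspace_of E) : R := `|val u|.

Let norm_ofD u w : norm_of (u + w) <= norm_of u + norm_of w.
Proof. exact: ler_normD. Qed.

Let norm_ofZ (a : R) u : norm_of (a *: u) = `|a| * norm_of u.
Proof. exact: normrZ. Qed.

Let norm_of_eq0 u : norm_of u = 0 -> u = 0.
Proof. by move=> /normr0_eq0 u0; apply: val_inj; rewrite u0 raddf0. Qed.

HB.instance Definition _ :=
  Lmodule_isNormed.Build R (subspace_of E) norm_ofD norm_ofZ norm_of_eq0.

End SubspaceOf.

Section Definitions.
Context {R : realType} {X : normedModType R}.
Implicit Types (S A Omega : set X) (x a v : X) (E : submodClosed X).

Definition boundary S : set X := closure S `\` S°.

(* X = E (+) R v with v != 0: the uniqueness of the coefficient of [v] forces
   [v] to be nonzero. *)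
Definition direct_sum_line E v : Prop :=
  forall x, exists! p : subspace_of E * R, x = val p.1 + p.2 *: v.

Definition closed_hyperplane E : Prop :=
  closed [set` E] /\ exists v, direct_sum_line E v.

(* Projection onto [E] along R v; meaningful when [direct_sum_line E v]. *)
Definition proj_along E v x : subspace_of E :=
  xget 0 [set u | exists r : R, x = val u + r *: v].

Definition clarke_tangent_cone A a : set X :=
  [set v | forall (x_ : nat -> X) (t_ : nat -> R),
     (forall n, A (x_ n)) -> x_ @ \oo --> a ->
     (forall n, 0 < t_ n) -> t_ @ \oo --> 0 ->
     exists2 v_ : nat -> X, v_ @ \oo --> v &
       \forall n \near \oo, A (x_ n + t_ n *: v_ n)].

Definition epi_lipschitzian S x : Prop :=
  exists v (gamma : R), [/\ v != 0, 0 < gamma &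
    forall t, 0 < t < gamma ->
      [set y + t *: w | y in S `&` ball x gamma & w in ball v gamma] `<=` S].

Record local_representation S x := LocalRepresentation {
  lr_dir : X ;
  lr_hyp : submodClosed X ;
  lr_nbhs : set X ;
  lr_fun : subspace_of lr_hyp -> R^o ;
  lr_dir_neq0 : lr_dir != 0 ;
  lr_closed_hyperplane : closed_hyperplane lr_hyp ;
  lr_direct_sum : direct_sum_line lr_hyp lr_dir ;
  lr_nbhsP : nbhs x lr_nbhs ;
  lr_lipschitz : exists2 U : set (subspace_of lr_hyp),
    nbhs (proj_along lr_hyp lr_dir x) U & [lipschitz lr_fun u | u in U] ;
  lr_epigraph : lr_nbhs `&` S = lr_nbhs `&`
    [set y | exists (u : subspace_of lr_hyp) (r : R),
               lr_fun u <= r /\ y = val u + r *: lr_dir]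
}.

End Definitions.

Definition strictly_hadamard_differentiable {R : realType}
    {V Y : normedModType R} (g : V -> Y) (x0 : V) : Prop :=
  exists2 Dg : {linear V -> Y}, continuous Dg &
    forall h : V,
      (fun q : R * (V * V) => let: (t, (x, u)) := q in
         t^-1 *: (g (x + t *: u) - g x))
      @ filter_prod (0 : R)^'+ (filter_prod (nbhs x0) (nbhs h)) --> Dg h.

(* Differentiability of the set [S] at [x], relative to the fixed local
   representation [L]. *)
Definition set_strictly_hadamard_differentiable {R : realType}
    {X : normedModType R} (S : set X) (x : X) (L : local_representation S x)
    : Prop :=
  strictly_hadamard_differentiable (@lr_fun _ _ _ _ L)
    (proj_along (lr_hyp L) (lr_dir L) x).

(* Main.v *)
Require Import Defs.
From HB Require Import structures.
From mathcomp Require Import all_boot all_order all_algebra.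
From mathcomp Require Import all_classical all_reals all_analysis.
From mathcomp Require Import lra.
Import Order.TTheory GRing.Theory Num.Theory.
Import numFieldNormedType.Exports.
Local Open Scope classical_set_scope.
Local Open Scope ring_scope.

(* Write x = u + r v with u in E, and let f be the local representation of S.
   The graph points u + f(u) v near xbar lie in S, so h + s v in T(S, xbar)
   forces the Clarke derivative of f at the projection of xbar in the direction
   h to be at most s. If both h + s v and its opposite are tangent, then, moving
   the base point from u to u + t h, the difference quotients of f in the
   direction h converge to s. Hence a hyperplane H in T(S, xbar) does not contain
   v, so it is the graph of a continuous linear form on E, which is the strict
   derivative of f. Conversely the graph of the strict derivative is a closed
   hyperplane, and each of its vectors h + s v is tangent: the difference
   quotients s_n of f along the given sequences give the tangent vectors
   h + s_n v. *)

(** * Coordinates in a direct sum of a hyperplane and a line *)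

(** The companion of [proj_along]. When [direct_sum_line E v] holds, exactly one [r] qualifies and
    the default 0 is never taken. *)
Definition coord_along {R : realType} {X : normedModType R}
    (E : submodClosed X) (v x : X) : R :=
  xget 0 [set r | x - r *: v \in E].

Lemma direct_sum_line_uniq {R : realType} {X : normedModType R}
    (E : submodClosed X) (v : X) (u u' : subspace_of E) (r r' : R) :
  direct_sum_line E v -> val u + r *: v = val u' + r' *: v -> u = u' /\ r = r'.
Proof.
move=> Ev e; have [[u0 r0] [_ uniq]] := Ev (val u + r *: v).
have := uniq (u, r) erefl; have := uniq (u', r') e.
by move=> [-> ->] [-> ->].
Qed.

Lemma proj_alongE {R : realType} {X : normedModType R}
    (E : submodClosed X) (v : X) (u : subspace_of E) (r : R) :
  direct_sum_line E v -> proj_along E v (val u + r *: v) = u.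
Proof.
move=> Ev; rewrite /proj_along; case: xgetP => [u' _ [r' /= e]|/(_ u)/=].
  by have [->] := direct_sum_line_uniq _ _ _ _ _ _ Ev e.
by case; exists r.
Qed.

Lemma coord_alongE {R : realType} {X : normedModType R}
    (E : submodClosed X) (v : X) (u : subspace_of E) (r : R) :
  direct_sum_line E v -> coord_along E v (val u + r *: v) = r.
Proof.
move=> Ev; rewrite /coord_along; case: xgetP => [r' _ /= e|/(_ r)/=].
  pose u' := exist (fun y => y \in E) _ e.
  have [|_ ->//] := direct_sum_line_uniq E v u u' r r' Ev.
  by rewrite /= subrK.
by rewrite addrK (valP u).
Qed.

Lemma coord_proj_along {R : realType} {X : normedModType R}
    (E : submodClosed X) (v x : X) : direct_sum_line E v ->
  x = val (proj_along E v x) + coord_along E v x *: v.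
Proof.
move=> Ev; have [[u r] [/= -> _]] := Ev x.
by rewrite proj_alongE // coord_alongE.
Qed.

Lemma val_proj_along {R : realType} {X : normedModType R}
    (E : submodClosed X) (v x : X) : direct_sum_line E v ->
  val (proj_along E v x) = x - coord_along E v x *: v.
Proof. by move=> Ev; rewrite {2}(coord_proj_along E v x Ev) addrK. Qed.

(** Uniqueness of the decomposition: combining the decompositions of [x] and [y] gives one of
    [a *: x + y], whose coefficient can be read off. The type [R^o] views the scalars as a module
    over themselves. *)
Lemma coord_along_linear {R : realType} {X : normedModType R}
    (E : submodClosed X) (v : X) : direct_sum_line E v ->
  linear (coord_along E v : X -> R^o).
Proof.
move=> Ev a x y.
rewrite -[RHS](coord_alongE E v (a *: proj_along E v x + proj_along E v y)) //.
congr coord_along.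
rewrite {1}(coord_proj_along E v x Ev) {1}(coord_proj_along E v y Ev).
by rewrite linearP scalerDr addrACA scalerA -scalerDl.
Qed.

(* [k^-1] is a lower bound for the distance from [v] to [E]. *)
Lemma coord_along_bounded {R : realType} {X : normedModType R}
    (E : submodClosed X) (v : X) : closed [set` E] -> direct_sum_line E v ->
  exists2 k : R, 0 < k & forall x, `|coord_along E v x| <= k * `|x|.
Proof.
move=> cE Ev.
(* A [v] in [E] would have two decompositions, 0 + 1 v and v + 0 v. *)
have vE : v \notin E.
  apply/negP => vE; pose u := exist (fun y => y \in E) v vE.
  have [|_ /eqP] := direct_sum_line_uniq E v 0 u 1 0 Ev.
    by rewrite /= add0r scale0r addr0 scale1r.
  by rewrite oner_eq0.
have : nbhs v (~` [set` E]).
  by apply: open_nbhs_nbhs; split; [exact: closed_openC|exact/negP].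
move=> /nbhs_ballP[e /= e0 ve]; exists e^-1; first by rewrite invr_gt0.
move=> x; have [->|c0] := eqVneq (coord_along E v x) 0.
  by rewrite normr0 mulr_ge0// invr_ge0 ltW.
rewrite mulrC ler_pdivlMr// leNgt; apply/negP => lt.
(* With c the coefficient of [x] and p its projection, v + c^-1 p = c^-1 x. If |x| < |c| e, the
   point - c^-1 p of [E] is thus within e of [v], in a ball that misses [E]. *)
apply: (ve (- (coord_along E v x)^-1 *: val (proj_along E v x))); last first.
  by rewrite /= rpredZ// (valP (proj_along E v x)).
rewrite -ball_normE /= scaleNr opprK val_proj_along// scalerBr scalerA mulVf//.
rewrite scale1r addrC subrK normrZ normfV mulrC ltr_pdivrMr ?normr_gt0//.
by rewrite mulrC.
Qed.

Lemma linear_le_norm_continuous {R : realType} {V W : normedModType R}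
    (g : {linear V -> W}) (k : R) : 0 < k ->
  (forall x, `|g x| <= k * `|x|) -> continuous g.
Proof.
move=> k0 gk; apply: bounded_linear_continuous; apply/bounded_funP => r.
by exists (k * r) => x xr; rewrite (le_trans (gk x))// ler_wpM2l// ltW.
Qed.

Lemma coord_along_continuous {R : realType} {X : normedModType R}
    (E : submodClosed X) (v : X) : closed [set` E] -> direct_sum_line E v ->
  continuous (coord_along E v : X -> R^o).
Proof.
move=> cE Ev; have [k k0 ck] := coord_along_bounded E v cE Ev.
pose c : {linear X -> R^o} := HB.pack (coord_along E v : X -> R^o)
  (GRing.isLinear.Build R X R^o _ _ (coord_along_linear E v Ev)).
exact: (linear_le_norm_continuous c k).
Qed.

Lemma proj_along_linear {R : realType} {X : normedModType R}
    (E : submodClosed X) (v : X) : direct_sum_line E v ->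
  linear (proj_along E v).
Proof.
move=> Ev a x y; apply: val_inj.
rewrite -[RHS]/(a *: val (proj_along E v x) + val (proj_along E v y)).
rewrite !val_proj_along// (coord_along_linear E v Ev) scalerDl opprD addrACA.
by rewrite scalerBr scalerA.
Qed.

Lemma proj_along_continuous {R : realType} {X : normedModType R}
    (E : submodClosed X) (v : X) : closed [set` E] -> direct_sum_line E v ->
  continuous (proj_along E v).
Proof.
move=> cE Ev; have [k k0 ck] := coord_along_bounded E v cE Ev.
pose p : {linear X -> subspace_of E} := HB.pack (proj_along E v)
  (GRing.isLinear.Build R X (subspace_of E) _ _ (proj_along_linear E v Ev)).
(* The constant comes from the triangle inequality for x - c(x) v with |c(x)| <= k |x|. *)
apply: (linear_le_norm_continuous p (1 + k * `|v|)).
  by rewrite ltr_wpDr// mulr_ge0// ltW.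
move=> x; rewrite [leLHS](_ : _ = `|val (proj_along E v x)|)//.
rewrite val_proj_along// (le_trans (ler_normB _ _))// mulrDl mul1r lerD2l.
by rewrite normrZ mulrAC ler_wpM2r.
Qed.

(** * Hyperplanes: kernels and complementary lines; Lipschitz bounds *)

Lemma kernel_closed_hyperplane {R : realType} {X : normedModType R}
    (g : {linear X -> R^o}) (v : X) : continuous g -> g v = 1 ->
  exists2 H : submodClosed X, closed_hyperplane H & [set` H] = g @^-1` [set 0].
Proof.
move=> gc gv.
have ker : GRing.subsemimod_closed (fun x => g x == 0).
  split; first split.
  - by rewrite unfold_in linear0.
  - by move=> x y /eqP gx /eqP gy; rewrite unfold_in linearD gx gy addr0.
  - by move=> a x /eqP gx; rewrite unfold_in linearZ/= gx scaler0.
pose H : submodClosed X := HB.pack (fun x => g x == 0 : bool)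
  (GRing.isSubmodClosed.Build R X (fun x => g x == 0) ker).
have HE : [set` H] = g @^-1` [set 0].
  by apply/seteqP; split=> x /= /eqP.
exists H => //; split.
  by rewrite HE; apply: closed_comp => [x _|]; [exact: gc|exact: closed_eq].
exists v => x.
(* Since [g v = 1], removing [g x *: v] from [x] lands in the kernel, so the line through [v] is a
   complement. *)
have xH : x - g x *: v \in H.
  by apply/eqP; rewrite linearB linearZ/= gv [_ *: _]mulr1 subrr.
exists (exist (fun y => y \in H) _ xH, g x); split=> /=; first by rewrite subrK.
move=> [[u uH] r] /= e; have gu : g u = 0 by exact/eqP.
have gx : g x = r.
  by rewrite e linearD linearZ/= gu gv add0r [_ *: _]mulr1.
by congr pair => //; apply: val_inj; rewrite /= gx e addrK.
Qed.

Lemma lipschitz_bound {R : realType} {V W : normedModType R} (f : V -> W)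
    (U : set V) : [lipschitz f u | u in U] ->
  exists2 k : R, 0 < k &
    forall x y, U x -> U y -> `|f x - f y| <= k * `|x - y|.
Proof.
move=> /pinfty_ex_gt0[k k0 fk]; exists k => // x y Ux Uy.
by apply: (fk (x, y)).
Qed.

(** The coefficient c along the given complement [w] has kernel [H], so c(v) is nonzero off [H], and
    c / c(v) is the coefficient along [v]. *)
Lemma direct_sum_line_of_notin {R : realType} {X : normedModType R}
    (H : submodClosed X) (v : X) :
  closed_hyperplane H -> v \notin H -> direct_sum_line H v.
Proof.
move=> [_ [w Hw]] vH.
pose c := coord_along H w : X -> R^o.
have cH u : u \in H -> c u = 0.
  move=> uH; have := coord_alongE H w (exist (fun y => y \in H) u uH) 0 Hw.
  by rewrite /= scale0r addr0.
have Hc u : c u = 0 -> u \in H.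
  move=> c0; rewrite (coord_proj_along H w u Hw) -/(c u) c0 scale0r addr0.
  exact: (valP (proj_along H w u)).
have cv : c v != 0 by apply: contra vH => /eqP/Hc.
have cD x y r : c (x + r *: y) = c x + r * c y.
  by rewrite addrC /c (coord_along_linear H w Hw) addrC.
move=> x; have xH : x - (c x / c v) *: v \in H.
  by apply: Hc; rewrite -scaleNr cD mulNr divfK// subrr.
exists (exist (fun y => y \in H) _ xH, c x / c v); split=> /=.
  by rewrite subrK.
move=> [[u uH] r] /= e.
have cx : c x / c v = r by rewrite e cD cH// add0r mulfK.
by congr pair => //; apply: val_inj; rewrite /= cx e addrK.
Qed.

(** * The local epigraph of the set and its boundary point *)

Lemma epigraphP {R : realType} {X : normedModType R} (S : set X) (x : X)
    (L : local_representation S x) (y : X) : lr_nbhs L y ->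
  S y <->
  lr_fun (proj_along (lr_hyp L) (lr_dir L) y)
    <= coord_along (lr_hyp L) (lr_dir L) y.
Proof.
move=> Oy; have Ev := lr_direct_sum L.
have /seteqP[/(_ y) sub1 /(_ y) sub2] := lr_epigraph L.
split=> [Sy|fy].
  have [_ [u [r [fu ->]]]] := sub1 (conj Oy Sy).
  by rewrite proj_alongE// coord_alongE.
suff /sub2[] : (lr_nbhs L `&` [set y | exists (u : subspace_of (lr_hyp L)) r,
    lr_fun u <= r /\ y = val u + r *: lr_dir L]) y by [].
split=> //; exists (proj_along (lr_hyp L) (lr_dir L) y).
exists (coord_along (lr_hyp L) (lr_dir L) y); split=> //.
exact: coord_proj_along.
Qed.

Lemma lipschitz_continuous_at {R : realType} {V W : normedModType R}
    (f : V -> W) (U : set V) (a : V) :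
  nbhs a U -> [lipschitz f u | u in U] -> {for a, continuous f}.
Proof.
move=> Ua /lipschitz_bound[k k0 fk].
apply/cvgrPdist_lt => e e0; near=> u.
apply: (le_lt_trans (fk _ _ _ _)); first exact: nbhs_singleton.
  by near: u.
rewrite mulrC -ltr_pdivlMr//; near: u.
by apply: cvgr_dist_lt => //; rewrite divr_gt0.
Unshelve. all: by end_near. Qed.

Lemma lr_fun_continuous {R : realType} {X : normedModType R} (S : set X)
    (x : X) (L : local_representation S x) :
  {for proj_along (lr_hyp L) (lr_dir L) x, continuous (lr_fun (l:=L))}.
Proof. by have [U Ux] := lr_lipschitz L; exact: lipschitz_continuous_at. Qed.

(** Closedness puts [x] in the epigraph; a strict inequality there would persist nearby by
    continuity and make [x] an interior point. *)
Lemma lr_fun_boundary {R : realType} {X : normedModType R} (S : set X)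
    (x : X) (L : local_representation S x) : closed S -> boundary S x ->
  lr_fun (proj_along (lr_hyp L) (lr_dir L) x)
    = coord_along (lr_hyp L) (lr_dir L) x.
Proof.
move=> cS [/cS Sx Sox]; have Ev := lr_direct_sum L.
have [cE _] := lr_closed_hyperplane L.
have /(epigraphP _ _ L) fx := nbhs_singleton (lr_nbhsP L).
apply/eqP; rewrite eq_le; apply/andP; split; first exact/fx.
rewrite leNgt; apply/negP => lt; apply: Sox; rewrite /interior/=.
have cf : (lr_fun (l:=L) \o proj_along (lr_hyp L) (lr_dir L)) y @[y --> x] -->
    lr_fun (proj_along (lr_hyp L) (lr_dir L) x).
  apply: continuous_comp; first exact: proj_along_continuous.
  exact: lr_fun_continuous.
have cc := coord_along_continuous _ _ cE Ev x.
(* The midpoint separates the two continuous sides on a whole neighbourhood of [x]. *)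
pose m := (lr_fun (proj_along (lr_hyp L) (lr_dir L) x)
    + coord_along (lr_hyp L) (lr_dir L) x) / 2.
near=> y; apply/(epigraphP _ _ L); first by near: y; exact: lr_nbhsP.
apply: (@le_trans _ _ m); apply: ltW; near: y.
  by apply: (cvgr_lt _ cf); rewrite /m; lra.
by apply: (cvgr_gt _ cc); rewrite /m; lra.
Unshelve. all: by end_near. Qed.

(** * Strict directional derivatives along filters and sequences *)

Lemma cvg_filter_pair {T U V : Type} (F : set_system T) (G : set_system U)
    (H : set_system V) {FF : Filter F} (f : T -> U) (g : T -> V) :
  f @ F `=>` G -> g @ F `=>` H -> (fun x => (f x, g x)) @ F `=>` filter_prod G H.
Proof.
move=> fG gH P [[A B] /= [GA HB] ABP].
have fA : F (f @^-1` A) by exact: fG.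
have gB : F (g @^-1` B) by exact: gH.
by apply: filterS2 fA gB => x Ax Bx; exact: (ABP (f x, g x)).
Qed.

Lemma cvg_add_scale_right0 {R : realType} {V : normedModType R} {T : Type}
    (F : set_system T) {FF : Filter F} (t : T -> R) (x u : T -> V) (a h : V) :
  t @ F --> (0 : R)^'+ -> x @ F --> a -> u @ F --> h ->
  (fun q => x q + t q *: u q) @ F --> a.
Proof.
move=> tF xF uF; rewrite -[a in X in _ --> X]addr0 -(scale0r h).
apply: cvgD => //; apply: cvgZ => //.
exact: cvg_trans tF (cvg_within _).
Qed.

(** Unlike in the Hadamard notion, the direction [h] stays fixed while the base point and the step
    vary; for Lipschitz functions the moving direction is recovered in [hadamard_of_directional]. *)
Definition strict_directional_derivative {R : realType} {V : normedModType R}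
    (f : V -> R^o) (a h : V) (s : R) : Prop :=
  (fun q : R * V => q.1^-1 *: (f (q.2 + q.1 *: h) - f q.2))
    @ filter_prod (0 : R)^'+ (nbhs a) --> (s : R^o).

Lemma cvg_at_right0 {R : realType} (t_ : nat -> R) :
  (forall n, 0 < t_ n) -> t_ @ \oo --> 0 -> t_ @ \oo --> (0 : R)^'+.
Proof.
move=> t0 tc A /tc A0; change (\forall n \near \oo, A (t_ n)); near=> n.
by have /(_ (t0 n)) : 0 < t_ n -> A (t_ n) by near: n.
Unshelve. all: by end_near. Qed.

Lemma hadamard_strict_directional {R : realType} {V : normedModType R}
    (f : V -> R^o) (a : V) (Dg : {linear V -> R^o}) (h : V) :
  (fun q : R * (V * V) => let: (t, (x, u)) := q in
     t^-1 *: (f (x + t *: u) - f x))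
    @ filter_prod (0 : R)^'+ (filter_prod (nbhs a) (nbhs h)) --> Dg h ->
  strict_directional_derivative f a h (Dg h).
Proof.
move=> cv; apply: (cvg_comp (fun q : R * V => (q.1, (q.2, h))) _ _ cv).
apply: cvg_filter_pair; first exact: cvg_fst.
by apply: cvg_filter_pair; [exact: cvg_snd|exact: cvg_cst].
Qed.

Lemma strict_directional_seq {R : realType} {V : normedModType R}
    (f : V -> R^o) (a h : V) (s : R) (t_ : nat -> R) (u_ : nat -> V) :
  strict_directional_derivative f a h s ->
  (forall n, 0 < t_ n) -> t_ @ \oo --> 0 -> u_ @ \oo --> a ->
  (fun n => (t_ n)^-1 *: (f (u_ n + t_ n *: h) - f (u_ n))) @ \oo --> (s : R^o).
Proof.
move=> cv t0 tc uc; apply: (cvg_comp (fun n => (t_ n, u_ n)) _ _ cv).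
by apply: cvg_filter_pair => //; exact: cvg_at_right0.
Qed.

(** A bridge from the product filter of the derivative to the sequences of the tangent cone: a
    counterexample is chosen in each box of size 1/(n+1). *)
Lemma not_near_seq {R : realType} {V : normedModType R} (P : R -> V -> Prop)
    (a : V) :
  ~ (\forall q \near filter_prod (0 : R)^'+ (nbhs a), P q.1 q.2) ->
  exists (t_ : nat -> R) (u_ : nat -> V), [/\ forall n, 0 < t_ n,
    t_ @ \oo --> 0, u_ @ \oo --> a & forall n, ~ P (t_ n) (u_ n)].
Proof.
move=> nP.
have ex n : exists q : R * V,
    [/\ 0 < q.1 < n.+1%:R^-1, `|a - q.2| < n.+1%:R^-1 & ~ P q.1 q.2].
  apply: contrapT => nex; apply: nP.
  exists ([set t | 0 < t < n.+1%:R^-1], ball a n.+1%:R^-1) => /=.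
    split; last exact: nbhsx_ballx.
    near=> t; apply/andP; split; near: t; first exact: nbhs_right_gt.
    exact: nbhs_right_lt.
  move=> [t u] /= [tn un]; apply: contrapT => nPtu; apply: nex.
  by exists (t, u); split=> //; move: un; rewrite -ball_normE.
have [q qP] := choice ex.
exists (fst \o q), (snd \o q).
have inv0 : (fun n => n.+1%:R^-1 : R) @ \oo --> 0 by exact: cvg_harmonic.
split=> [n|||n]; try by have [/andP[]] := qP n.
- apply/cvgrPdist_lt => e e0; near=> n; have [/andP[q0 qn] _ _] := qP n.
  rewrite sub0r normrN gtr0_norm// (lt_trans qn)//.
  by near: n; exact: (cvgr_lt _ inv0).
- apply/cvgrPdist_lt => e e0; near=> n; have [_ qn _] := qP n.
  by rewrite (lt_trans qn)//; near: n; exact: (cvgr_lt _ inv0).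
Unshelve. all: by end_near. Qed.

(** The second estimate, taken at the shifted base point u + t h, leads back to u and so bounds the
    quotient at u in the direction [h] from below by s - e. *)
Lemma upper_estimates_directional {R : realType} {V : normedModType R}
    (f : V -> R^o) (a h : V) (s : R) :
  (forall e, 0 < e -> \forall q \near filter_prod (0 : R)^'+ (nbhs a),
    f (q.2 + q.1 *: h) - f q.2 <= q.1 * (s + e)) ->
  (forall e, 0 < e -> \forall q \near filter_prod (0 : R)^'+ (nbhs a),
    f (q.2 + q.1 *: (- h)) - f q.2 <= q.1 * (- s + e)) ->
  strict_directional_derivative f a h s.
Proof.
move=> up down; apply/cvgrPdist_le => e e0.
have shift : (fun q : R * V => (q.1, q.2 + q.1 *: h))
    @ filter_prod (0 : R)^'+ (nbhs a) --> filter_prod (0 : R)^'+ (nbhs a).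
  apply: cvg_filter_pair; first exact: cvg_fst.
  by apply: cvg_add_scale_right0; [exact: cvg_fst|exact: cvg_snd|exact: cvg_cst].
have pos : \forall q \near filter_prod (0 : R)^'+ (nbhs a), 0 < q.1.
  exact: (@cvg_fst _ _ _ _ _ _ (nbhs_right_gt 0)).
have := shift _ (down _ e0); rewrite /= => down'.
near=> q.
have q0 : 0 < q.1 by near: q.
have u1 : f (q.2 + q.1 *: h) - f q.2 <= q.1 * (s + e) by near: q; exact: up.
have : f (q.2 + q.1 *: h + q.1 *: (- h)) - f (q.2 + q.1 *: h) <= q.1 * (- s + e).
  by near: q.
rewrite scalerN addrK => u2.
rewrite distrC ler_distl -[_ *: _]/(_^-1 * _) mulrC ler_pdivlMr// ler_pdivrMr//.
by apply/andP; split; lra.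
Unshelve. all: by end_near. Qed.

(** Replacing the moving direction u by [h] changes the difference quotient by at most k |u - h|. *)
Lemma hadamard_of_directional {R : realType} {V : normedModType R}
    (f : V -> R^o) (a : V) (U : set V) (Dg : {linear V -> R^o}) :
  nbhs a U -> [lipschitz f u | u in U] -> continuous Dg ->
  (forall h, strict_directional_derivative f a h (Dg h)) ->
  strictly_hadamard_differentiable f a.
Proof.
move=> Ua /lipschitz_bound[k k0 fk] Dgc dir; exists Dg => // h.
rewrite (_ : (fun q => _) = fun q : R * (V * V) =>
    q.1^-1 *: (f (q.2.1 + q.1 *: q.2.2) - f q.2.1)); last first.
  by apply/funext => -[? []].
set F := filter_prod _ _.
have tF : (fst : R * (V * V) -> R) @ F --> (0 : R)^'+ by exact: cvg_fst.
have xF : (fun q : R * (V * V) => q.2.1) @ F --> a.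
  exact: cvg_comp cvg_snd cvg_fst.
have uF : (fun q : R * (V * V) => q.2.2) @ F --> h.
  exact: cvg_comp cvg_snd cvg_snd.
have dirF : (fun q : R * (V * V) =>
     q.1^-1 *: (f (q.2.1 + q.1 *: h) - f q.2.1)) @ F --> Dg h.
  apply: (cvg_comp (fun q : R * (V * V) => (q.1, q.2.1)) _ _ (dir h)).
  exact: cvg_filter_pair.
have pos : \forall q \near F, 0 < q.1 by exact: tF _ (nbhs_right_gt 0).
have Uu : \forall q \near F, U (q.2.1 + q.1 *: q.2.2).
  exact: cvg_add_scale_right0 tF xF uF _ Ua.
have Uh : \forall q \near F, U (q.2.1 + q.1 *: h).
  exact: cvg_add_scale_right0 tF xF (cvg_cst h) _ Ua.
apply/cvgrPdist_lt => e e0.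
(* Half of e goes to the quotient in the fixed direction; the other half, divided by k, bounds |h -
   u|. *)
have e2 : 0 < e / 2 by rewrite divr_gt0.
have ek : 0 < e / 2 / k by rewrite divr_gt0.
move/cvgrPdist_lt : dirF => /(_ _ e2) dirF.
move/cvgrPdist_lt : uF => /(_ _ ek) uF.
near=> q.
have q0 : 0 < q.1 by near: q.
set A := q.1^-1 *: (f (q.2.1 + q.1 *: h) - f q.2.1).
have A1 : `|Dg h - A| < e / 2.
  by rewrite /A; near: q.
apply: le_lt_trans (ler_distD A _ _) _.
rewrite [e]splitr; apply: ltrD => //.
rewrite /A -scalerBr opprB addrA subrK normrZ normfV gtr0_norm//.
rewrite mulrC ltr_pdivrMr//.
apply: (le_lt_trans (fk _ _ _ _)); [by near: q|by near: q|].
rewrite opprD addrACA subrr add0r -scalerBr normrZ gtr0_norm//.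
rewrite mulrCA [ltRHS]mulrC ltr_pM2l// mulrC -ltr_pdivlMr//.
by near: q.
Unshelve. all: by end_near. Qed.

(** * Tangent vectors and difference quotients *)

Lemma cvg_add_scale_seq {R : realType} {V : normedModType R} (t_ : nat -> R)
    (x_ u_ : nat -> V) (a h : V) : (forall n, 0 < t_ n) -> t_ @ \oo --> 0 ->
  x_ @ \oo --> a -> u_ @ \oo --> h -> (fun n => x_ n + t_ n *: u_ n) @ \oo --> a.
Proof.
move=> t0 tc xa uh; apply: cvg_add_scale_right0 xa uh.
exact: cvg_at_right0.
Qed.

Lemma proj_coord_add_scale {R : realType} {X : normedModType R}
    (E : submodClosed X) (v x w : X) (t : R) : direct_sum_line E v ->
  proj_along E v (x + t *: w) = proj_along E v x + t *: proj_along E v w /\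
  coord_along E v (x + t *: w) = coord_along E v x + t * coord_along E v w.
Proof.
move=> Ev; rewrite addrC (proj_along_linear E v Ev) addrC; split=> //.
by rewrite (coord_along_linear E v Ev) addrC.
Qed.

Lemma val_subspace_continuous {R : realType} {X : normedModType R}
    (E : submodClosed X) : continuous (val : subspace_of E -> X).
Proof.
apply: (linear_le_norm_continuous (val : {linear subspace_of E -> X}) 1) => //.
by move=> u; rewrite mul1r.
Qed.

(** Along the chosen vectors h + d_n v, with d_n the quotient of f at the projection of x_n, f and
    the coordinate along v rise by the same amount t_n d_n, so the epigraph inequality at x_n is
    carried over. *)
Lemma clarke_tangent_cone_graph {R : realType} {X : normedModType R}
    (S : set X) (x : X) (L : local_representation S x)
    (h : subspace_of (lr_hyp L)) (s : R) :
  strict_directional_derivative (lr_fun (l:=L))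
    (proj_along (lr_hyp L) (lr_dir L) x) h s ->
  clarke_tangent_cone S x (val h + s *: lr_dir L).
Proof.
move=> dir x_ t_ Sx xc t0 tc; have Ev := lr_direct_sum L.
have [cE _] := lr_closed_hyperplane L.
set p := proj_along (lr_hyp L) (lr_dir L) in dir *.
have pc : (p \o x_) @ \oo --> p x.
  exact: continuous_cvg (proj_along_continuous _ _ cE Ev x) xc.
have dc := strict_directional_seq _ _ _ _ _ _ dir t0 tc pc.
set d := (fun n => _) in dc.
have vc : (fun n => val h + d n *: lr_dir L) @ \oo --> val h + s *: lr_dir L.
  by apply: cvgD; [exact: cvg_cst|exact: cvgZr_tmp].
exists (fun n => val h + d n *: lr_dir L) => //.
have yc := cvg_add_scale_seq _ _ _ _ _ t0 tc xc vc.
near=> n.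
have On : lr_nbhs L (x_ n) by near: n; exact: xc (lr_nbhsP L).
apply/(epigraphP _ _ L); first by near: n; exact: yc (lr_nbhsP L).
have [-> ->] := proj_coord_add_scale _ _ (x_ n)
  (val h + d n *: lr_dir L) (t_ n) Ev.
rewrite proj_alongE// coord_alongE//.
have fx : lr_fun (p (x_ n)) <= coord_along (lr_hyp L) (lr_dir L) (x_ n).
  exact/epigraphP.
have -> : t_ n * d n = lr_fun (p (x_ n) + t_ n *: h) - lr_fun (p (x_ n)).
  exact: (mulVKf (lt0r_neq0 (t0 n))).
by rewrite addrCA lerDl subr_ge0.
Unshelve. all: by end_near. Qed.

(** By contradiction: violating pairs (t_n, u_n) are lifted to the graph of f, and tangency supplies
    w_n tending to [w] for which the moved points stay in the epigraph. This bounds the increment of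
    f along the projection of w_n; the Lipschitz bound then passes to that of [w]. *)
Lemma clarke_tangent_upper_estimate {R : realType} {X : normedModType R}
    (S : set X) (x : X) (L : local_representation S x) (w : X) (e : R) :
  closed S -> boundary S x -> clarke_tangent_cone S x w -> 0 < e ->
  \forall q \near filter_prod (0 : R)^'+
      (nbhs (proj_along (lr_hyp L) (lr_dir L) x)),
    lr_fun (q.2 + q.1 *: proj_along (lr_hyp L) (lr_dir L) w) - lr_fun q.2
      <= q.1 * (coord_along (lr_hyp L) (lr_dir L) w + e).
Proof.
move=> cS bx Tw e0; have Ev := lr_direct_sum L.
have fx := lr_fun_boundary _ _ L cS bx.
have [cE _] := lr_closed_hyperplane L.
have [U Ux /lipschitz_bound[k k0 fk]] := lr_lipschitz L.
have fc := lr_fun_continuous _ _ L.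
set v := lr_dir L in Ev fx Ux fc *; set f := lr_fun (l:=L) in fx fk fc *.
set p := proj_along (lr_hyp L) v in fx Ux fc *.
set c := coord_along (lr_hyp L) v in fx *.
apply: contrapT => /(not_near_seq
  (fun t u => f (u + t *: p w) - f u <= t * (c w + e))).
move=> [t_ [u_ [t0 tc uc nle]]].
pose y_ n := val (u_ n) + f (u_ n) *: v.
(* The limit is [x] because the boundary point lies on the graph of f. *)
have yc : y_ @ \oo --> x.
  rewrite [x](coord_proj_along _ _ _ Ev) -/v -/p -/(c x) -fx.
  apply: cvgD; last apply: cvgZr_tmp.
    exact: continuous_cvg (val_subspace_continuous _ _) uc.
  exact: continuous_cvg fc uc.
have yS : \forall n \near \oo, S (y_ n).
  near=> n; apply/(epigraphP _ _ L); first by near: n; exact: yc (lr_nbhsP L).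
  by rewrite proj_alongE// coord_alongE.
(* The cone quantifies over sequences lying in [S] from the first term on. *)
pose x_ n := if y_ n \in S then y_ n else x.
have [cSx _] := bx; have Sx : S x by exact: cS.
have xS n : S (x_ n) by rewrite /x_; case: ifPn => [|_//]; rewrite inE.
have xy : \forall n \near \oo, x_ n = y_ n.
  by apply: filterS yS => n Sn; rewrite /x_ ifT// inE.
have xc : x_ @ \oo --> x.
  by apply: cvg_trans yc; apply: near_eq_cvg; apply: filterS xy => n ->.
have [w_ wc wS] := Tw x_ t_ xS xc t0 tc.
have zc := cvg_add_scale_seq _ _ _ _ _ t0 tc xc wc.
have pwc : (p \o w_) @ \oo --> p w.
  exact: continuous_cvg (proj_along_continuous _ _ cE Ev w) wc.
have cwc : (c \o w_) @ \oo --> c w.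
  exact: continuous_cvg (coord_along_continuous _ _ cE Ev w) wc.
have U1 : \forall n \near \oo, U (u_ n + t_ n *: p (w_ n)).
  exact: cvg_add_scale_seq _ _ _ _ _ t0 tc uc pwc _ Ux.
have U2 : \forall n \near \oo, U (u_ n + t_ n *: p w).
  exact: cvg_add_scale_seq _ _ _ _ _ t0 tc uc (cvg_cst (p w)) _ Ux.
(* One half of e absorbs c(w_n) - c(w), the other the Lipschitz cost of replacing p(w_n) by p(w). *)
have e2 : 0 < e / 2 by rewrite divr_gt0.
have ek : 0 < e / 2 / k by rewrite divr_gt0.
move/cvgrPdist_lt : pwc => /(_ _ ek) pwc.
have cw_lt : \forall n \near \oo, c (w_ n) < c w + e / 2.
  by apply: (cvgr_lt _ cwc); rewrite ltrDl.
(* The estimate fails at every n, so a single n where it holds is a contradiction. *)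
suff [n] : exists n, f (u_ n + t_ n *: p w) - f (u_ n) <= t_ n * (c w + e).
  exact: nle.
near \oo => n; exists n.
have zS : S (x_ n + t_ n *: w_ n) by near: n.
have zO : lr_nbhs L (x_ n + t_ n *: w_ n) by near: n; exact: zc (lr_nbhsP L).
move/(epigraphP _ _ L _ zO) : zS.
have [-> ->] := proj_coord_add_scale _ _ (x_ n) (w_ n) (t_ n) Ev.
have -> : x_ n = y_ n by near: n.
rewrite proj_alongE// coord_alongE// -/v -/p -/c -/f => fz.
have : `|f (u_ n + t_ n *: p w) - f (u_ n + t_ n *: p (w_ n))| <= t_ n * (e / 2).
  apply: (le_trans (fk _ _ _ _)); [by near: n|by near: n|].
  rewrite opprD addrACA subrr add0r -scalerBr normrZ gtr0_norm//.
  rewrite mulrCA ler_pM2l// mulrC -ler_pdivlMr// ltW//.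
  by near: n.
have : t_ n * c (w_ n) <= t_ n * (c w + e / 2).
  by rewrite ler_pM2l// ltW//; near: n.
rewrite ler_distl => cn /andP[_ fn].
rewrite lerBlDl (le_trans fn)// (le_trans (lerD fz (lexx _)))//.
rewrite -addrA lerD2l (le_trans (lerD cn (lexx _)))//.
by rewrite -mulrDr -addrA -splitr.
Unshelve. all: by end_near. Qed.

(** * The two implications *)

Lemma tangent_hyperplane_of_hadamard {R : realType} {X : normedModType R}
    (S : set X) (x : X) (L : local_representation S x) :
  set_strictly_hadamard_differentiable L ->
  exists H : submodClosed X,
    closed_hyperplane H /\ [set` H] `<=` clarke_tangent_cone S x.
Proof.
move=> [Dg Dgc dir]; have Ev := lr_direct_sum L.
have [cE _] := lr_closed_hyperplane L.
pose c := coord_along (lr_hyp L) (lr_dir L) : X -> R^o.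
pose p := proj_along (lr_hyp L) (lr_dir L).
(* In the coordinates p and c, the graph of [Dg] is the kernel of c - Dg p, a form taking the value
   1 at the direction of the representation. *)
have glin : linear (fun y => c y - Dg (p y) : R^o).
  move=> a y z; rewrite /c /p (coord_along_linear _ _ Ev).
  rewrite (proj_along_linear _ _ Ev) linearP opprD addrACA.
  by rewrite scalerBr.
pose g : {linear X -> R^o} := HB.pack (fun y => c y - Dg (p y) : R^o)
  (GRing.isLinear.Build R X R^o _ _ glin).
have gc : continuous g.
  move=> y; apply: cvgB; first exact: coord_along_continuous.
  by apply: continuous_comp (proj_along_continuous _ _ cE Ev y) (Dgc _).
have gv : g (lr_dir L) = 1.
  have e : lr_dir L = val (0 : subspace_of (lr_hyp L)) + 1 *: lr_dir L.
    by rewrite scale1r raddf0 add0r.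
  rewrite -[LHS]/(c _ - Dg (p _)) e.
  by rewrite /c /p proj_alongE// coord_alongE// linear0 subr0.
have [H Hhyp HE] := kernel_closed_hyperplane g _ gc gv.
exists H; split=> // w; rewrite HE => /subr0_eq cw.
rewrite (coord_proj_along _ _ w Ev) -/(c w) cw.
by apply: clarke_tangent_cone_graph; exact: hadamard_strict_directional.
Qed.

(** Otherwise the opposite direction would be tangent too. Its projection is 0 and its coefficient
    -1, so the upper estimate would bound a zero increment of f by a negative number. *)
Lemma direction_notin_tangent_hyperplane {R : realType} {X : normedModType R}
    (S : set X) (x : X) (L : local_representation S x) (H : submodClosed X) :
  closed S -> boundary S x -> [set` H] `<=` clarke_tangent_cone S x ->
  lr_dir L \notin H.
Proof.
move=> cS bx HT; apply/negP => vH; have Ev := lr_direct_sum L.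
have e : - lr_dir L = val (0 : subspace_of (lr_hyp L)) + (-1) *: lr_dir L.
  by rewrite scaleN1r raddf0 add0r.
have NvT : clarke_tangent_cone S x (- lr_dir L) 
  by apply: HT; rewrite /= -scaleN1r rpredZ.
(* Any positive constant below 1 in place of 1/2 would keep the bound t (-1 + e) negative. *)
have := clarke_tangent_upper_estimate _ _ L _ (1 / 2) cS bx NvT.
rewrite e proj_alongE// coord_alongE// => est.
suff : (0 : R) < 0 by rewrite ltxx.
near (filter_prod (0 : R)^'+ (nbhs (proj_along (lr_hyp L) (lr_dir L) x))) => q.
have : 0 <= q.1 * (- 1 + 1 / 2).
  apply: le_trans (_ : lr_fun (q.2 + q.1 *: 0) - lr_fun q.2 <= _).
    by rewrite scaler0 addr0 subrr.
  by near: q; apply: est; lra.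
have : 0 < q.1.
  near: q; exact: (@cvg_fst _ _ _ _ _ _ (nbhs_right_gt 0)).
nra.
Unshelve. all: by end_near. Qed.

Theorem theorem4p2 (R : realType) (X : completeNormedModType R)
    (S : set X) (xbar : X) (hS : closed S) (hx : boundary S xbar)
    (hepi : epi_lipschitzian S xbar) (L : local_representation S xbar) :
  set_strictly_hadamard_differentiable L <->
  exists H : submodClosed X,
    closed_hyperplane H /\ [set` H] `<=` clarke_tangent_cone S xbar.
Proof.
split; first exact: tangent_hyperplane_of_hadamard.
move=> [H [Hhyp HT]]; have Ev := lr_direct_sum L.
have vH := direction_notin_tangent_hyperplane _ _ L H hS hx HT.
have Hv := direct_sum_line_of_notin _ _ Hhyp vH.
set v := lr_dir L in Ev Hv vH *.
have [U Ux Uf] := lr_lipschitz L.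
(* [H] is the graph of this form: u + Df(u) v is the projection of u onto [H] along [v]. *)
pose Df := (fun u => - coord_along H v (val u)) : subspace_of (lr_hyp L) -> R^o.
have Dlin : linear Df.
  by move=> a y z; rewrite /Df linearP (coord_along_linear _ _ Hv) opprD scalerN.
pose Dg : {linear subspace_of (lr_hyp L) -> R^o} := HB.pack Df
  (GRing.isLinear.Build R (subspace_of (lr_hyp L)) R^o _ _ Dlin).
apply: (hadamard_of_directional _ _ _ Dg Ux Uf).
  have [cH _] := Hhyp; have [k k0 ck] := coord_along_bounded _ _ cH Hv.
  apply: (linear_le_norm_continuous Dg k) => // u.
  by rewrite (le_trans _ (ck (val u)))// normrN.
move=> h; pose w := val h + Dg h *: v.
have wH : w \in H.
  rewrite /w scaleNr -val_proj_along//; exact: (valP (proj_along H v _)).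
have wE : - w = val (- h) + (- Dg h) *: v by rewrite /w opprD -scaleNr raddfN.
have pw : proj_along (lr_hyp L) v w = h by rewrite proj_alongE.
have cw : coord_along (lr_hyp L) v w = Dg h by rewrite coord_alongE.
have pNw : proj_along (lr_hyp L) v (- w) = - h by rewrite wE proj_alongE.
have cNw : coord_along (lr_hyp L) v (- w) = - Dg h by rewrite wE coord_alongE.
(* To be used for both [w] and [- w], which are tangent because [H] is a subspace; they give the
   upper estimates in the directions [h] and [- h]. *)
have upper w' e : w' \in H -> 0 < e -> _ := fun w'H e0 =>
  clarke_tangent_upper_estimate _ _ L w' e hS hx (HT _ w'H) e0.
apply: upper_estimates_directional => e e0.
  by have := upper w e wH e0; rewrite pw cw.
have NwH : - w \in H by rewrite -scaleN1r rpredZ.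
by have := upper (- w) e NwH e0; rewrite pNw cNw.
Qed.
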